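(* Let $F$ be a field with $\operatorname{char}F\neq 2$, and in $F(\{x\})$ put $$E_1=(x^2)^3-(x^3)^2,\qquad E_2=(x^3)^2+x(x(x^2)^2)-x^2x^4-x(x^2x^3).$$ Then $$\mathfrak D(E_1;q,r,s)=2(2r-1)(2s-1)(q-rs),$$ $$\mathfrak D(E_2;q,r,s)=(2r-1)(2s-1)\big[(q-1)(2q-r-s)-(r-s)^2\big]=(2r-1)(2s-1)\big[2q^2-(r+s+2)q-(r-s)^2+r+s\big].$$ In particular, for any $E\in\mathcal E_6$, $\mathfrak D(E;q,r,s)$ is at most quadratic in $q$, and it is linear in $q$ (i.e. of degree exactly one in $q$) if and only if $E$ is a nonzero multiple of $E_1$.
   Context: $F(\{x\})$ is the free commutative nonassociative $F$-algebra on one generator $x$ (without unit), with basis the commutative nonassociative monomials (parenthesized words) in $x$. Principal powers: $x^1=x$, $x^{n+1}=x\,x^n$; $(u)^n$ denotes the $n$th principal power of $u$. The Peirce operator $\rho:F(\{x\})\to F[q]$ is the unique $F$-linear map with $\rho(x;q)=1$ and $\rho(uv;q)=q(\rho(u;q)+\rho(v;q))$ for monomials $u,v$. $P$ is evanescent if $\rho(P;q)=0$. $\mathcal E_6$ is the $F$-vector space of evanescent homogeneous polynomials of degree $6$ in $F(\{x\})$ (together with $0$). The second-order Peirce operator $\mathfrak D:F(\{x\})\to F[q,r,s]$ is the unique $F$-linear map with $\mathfrak D(x;q,r,s)=0$ and $\mathfrak D(uv;q,r,s)=q(\mathfrak D(u;q,r,s)+\mathfrak D(v;q,r,s))+\rho(u;r)\rho(v;s)+\rho(u;s)\rho(v;r)$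 for monomials $u,v$. *)

(* Defs.v *)
From HB Require Import structures.
From mathcomp Require Import all_boot all_algebra.
From mathcomp Require Import generic_quotient.
From mathcomp.multinomials Require Import freeg mpoly.

Set Implicit Arguments.
Unset Strict Implicit.
Unset Printing Implicit Defensive.

Import GRing.Theory.

Local Open Scope quotient_scope.
Local Open Scope ring_scope.

(* A nonassociative monomial in one generator is a binary tree; a commutative
   one is a tree up to exchanging the two factors at any node. *)
Inductive nmon : Type := NX | NM of nmon & nmon.

Fixpoint nmon_encode (t : nmon) : GenTree.tree unit :=
  match t with
  | NX => GenTree.Leaf tt
  | NM u v => GenTree.Node 0 [:: nmon_encode u; nmon_encode v]
  end.

Fixpoint nmon_decode (t : GenTree.tree unit) : option nmon :=
  match t with
  | GenTree.Leaf _ => Some NX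
  | GenTree.Node _ [:: u; v] =>
      match nmon_decode u, nmon_decode v with
      | Some u', Some v' => Some (NM u' v')
      | _, _ => None
      end
  | _ => None
  end.

Lemma nmon_encodeK : pcancel nmon_encode nmon_decode.
Proof. by elim=> //= u -> v ->. Qed.

HB.instance Definition _ := Choice.copy nmon (pcan_type nmon_encodeK).

Fixpoint ceq (s t : nmon) : bool :=
  match s, t with
  | NX, NX => true
  | NM u v, NM u' v' => ceq u u' && ceq v v' || ceq u v' && ceq v u'
  | _, _ => false
  end.

Lemma ceq_refl : reflexive ceq.
Proof. by elim=> //= u -> v ->. Qed.

Lemma ceq_sym : ssrbool.symmetric ceq.
Proof.
elim=> [|u IHu v IHv] [|u' v'] //=.
by rewrite !(IHu, IHv); congr orb; rewrite andbC.
Qed.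

Lemma ceq_trans : transitive ceq.
Proof.
move=> t s w; elim: t s w => [|u IHu v IHv] [|u1 v1] [|u2 v2] //=.
by case/orP=> /andP[a1 b1]; case/orP=> /andP[a2 b2]; apply/orP;
  [left|right|right|left]; apply/andP; split;
  first [exact: IHu a1 a2 | exact: IHv a1 b2 | exact: IHv b1 b2
        | exact: IHu b1 a2 | exact: IHv a1 a2 | exact: IHu b1 b2
        | exact: IHu a1 b2 | exact: IHv b1 a2].
Qed.

Canonical ceq_equiv := EquivRel ceq ceq_refl ceq_sym ceq_trans.

Definition cmon : Type := {eq_quot ceq}.
HB.instance Definition _ := Choice.on cmon.
HB.instance Definition _ := Quotient.on cmon.
HB.instance Definition _ : EqQuotient nmon ceq cmon := EqQuotient.on cmon.

Definition cX : cmon := \pi_cmon NX.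
Definition cmul (u v : cmon) : cmon := \pi_cmon (NM (repr u) (repr v)).

Lemma ceq_repr (t : nmon) : ceq (repr (\pi_cmon t)) t.
Proof. by rewrite -[ceq _ _]/(ceq_equiv _ _) -eqmodE reprK. Qed.

Lemma cmul_pi (s t : nmon) :
  cmul (\pi_cmon s) (\pi_cmon t) = \pi_cmon (NM s t).
Proof. by apply/eqmodP; rewrite /= !ceq_repr. Qed.

Lemma cmulC : commutative cmul.
Proof.
by move=> u v; apply/eqmodP; rewrite /= !ceq_refl orbT.
Qed.

Lemma cmon_ind (P : cmon -> Prop) :
  P cX -> (forall u v, P u -> P v -> P (cmul u v)) -> forall m, P m.
Proof.
move=> PX PM; elim/quotW; elim=> // s IHs t IHt.
by rewrite -cmul_pi; apply: PM.
Qed.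

Fixpoint nmon_deg (t : nmon) : nat :=
  if t is NM u v then (nmon_deg u + nmon_deg v)%N else 1%N.

Definition cmon_deg (m : cmon) : nat := nmon_deg (repr m).

Lemma nmon_deg_ceq (s t : nmon) : ceq s t -> nmon_deg s = nmon_deg t.
Proof.
elim: s t => [|u IHu v IHv] [|u' v'] //=.
by case/orP=> /andP[/IHu -> /IHv ->] //; rewrite addnC.
Qed.

Lemma cmon_degX : cmon_deg cX = 1%N.
Proof. exact: nmon_deg_ceq (ceq_repr NX). Qed.

Lemma cmon_degM (u v : cmon) : cmon_deg (cmul u v) = (cmon_deg u + cmon_deg v)%N.
Proof. exact: nmon_deg_ceq (ceq_repr (NM _ _)). Qed.

Section LinearExtension.
Variables (R : nzRingType) (K : choiceType) (M : lmodType R) (f : K -> M).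

HB.instance Definition _ :=
  GRing.isZmodMorphism.Build {freeg K / R} M (fglift f) (lift_is_additive f).

Lemma fglift_is_scalable : scalable (fglift f : {freeg K / R} -> M).
Proof.
move=> c D; rewrite -{2}(freeg_sumE D) [c *: D]/(fgscale c D) /fgscale.
rewrite !raddf_sum /=; apply: eq_bigr => m _.
by rewrite !liftU scalerA.
Qed.

HB.instance Definition _ :=
  GRing.isScalable.Build R {freeg K / R} M *:%R (fglift f) fglift_is_scalable.
End LinearExtension.

Notation fcna F := {freeg cmon / F}.

Section FreeCommutativeNonassociative.
Variable F : fieldType.
Implicit Types (P Q : fcna F) (u v m : cmon).

Definition gen : fcna F := << cX >>.

Definition nmul P Q : fcna F :=
  fglift (fun u => fglift (fun v => << cmul u v >> : fcna F) Q) P.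

(* No unit is available, so the exponent is meant to be positive. *)
Definition npow P (n : nat) : fcna F := iter n.-1 (nmul P) P.

Lemma nmulU u v : nmul << u >> << v >> = << cmul u v >>.
Proof. by rewrite /nmul !liftU !scale1r. Qed.

Lemma fglift_addf (M : lmodType F) (f g : cmon -> M) P :
  fglift (fun u => f u + g u) P = fglift f P + fglift g P.
Proof.
rewrite -(freeg_sumE P) !raddf_sum -big_split; apply: eq_bigr => m _.
by rewrite /= !liftU scalerDr.
Qed.

Lemma fglift_scalef (M : lmodType F) (c : F) (f : cmon -> M) P :
  fglift (fun u => c *: f u) P = c *: fglift f P.
Proof.
rewrite -(freeg_sumE P) !raddf_sum; apply: eq_bigr => m _.
by rewrite /= !liftU !scalerA mulrC.
Qed.

Lemma eq_fglift (M : lmodType F) (f g : cmon -> M) :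
  f =1 g -> fglift f =1 fglift g.
Proof.
move=> fg P; rewrite -(freeg_sumE P) !raddf_sum; apply: eq_bigr => m _.
by rewrite /= !liftU fg.
Qed.

Lemma nmul_linearl Q : linear (nmul^~ Q).
Proof. by move=> c P1 P2; rewrite /nmul linearP. Qed.

Lemma nmul_linearr P : linear (nmul P).
Proof.
move=> c Q1 Q2; rewrite /nmul -fglift_scalef -fglift_addf.
by apply: eq_fglift => u; rewrite linearP.
Qed.

Lemma nmulC : commutative nmul.
Proof.
move=> P Q; rewrite -(freeg_sumE P) -(freeg_sumE Q).
rewrite /nmul !raddf_sum.
under eq_bigr => u _ do rewrite /= liftU !raddf_sum.
under [RHS]eq_bigr => u _ do rewrite /= liftU !raddf_sum.
rewrite exchange_big; apply: eq_bigr => v _; apply: eq_bigr => u _.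
by rewrite /= !liftU !scalerA mulrC cmulC.
Qed.

Fixpoint nmon_rho (t : nmon) : {poly F} :=
  if t is NM u v then 'X * (nmon_rho u + nmon_rho v) else 1.

Lemma nmon_rho_ceq (s t : nmon) : ceq s t -> nmon_rho s = nmon_rho t.
Proof.
elim: s t => [|u IHu v IHv] [|u' v'] //=.
by case/orP=> /andP[/IHu -> /IHv ->] //; rewrite addrC.
Qed.

Definition rho : fcna F -> {poly F} := fglift (fun m => nmon_rho (repr m)).

(* The value rho(P; a) at an element a of a commutative F-algebra. *)
Definition rho_at (A : comAlgType F) (P : fcna F) (a : A) : A :=
  horner_alg a (rho P).

Lemma rho_gen : rho gen = 1.
Proof. by rewrite /rho liftU scale1r (nmon_rho_ceq (ceq_repr NX)). Qed.

Lemma rhoM u v :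
  rho << cmul u v >> = 'X * (rho << u >> + rho << v >>).
Proof.
by rewrite /rho !liftU !scale1r (nmon_rho_ceq (ceq_repr (NM _ _))).
Qed.

Definition vq : 'I_3 := @Ordinal 3 0 isT.
Definition vr : 'I_3 := @Ordinal 3 1 isT.
Definition vs : 'I_3 := @Ordinal 3 2 isT.

Definition q_ : {mpoly F[3]} := 'X_vq.
Definition r_ : {mpoly F[3]} := 'X_vr.
Definition s_ : {mpoly F[3]} := 'X_vs.

Fixpoint nmon_D2 (t : nmon) : {mpoly F[3]} :=
  if t is NM u v then
    q_ * (nmon_D2 u + nmon_D2 v)
    + horner_alg r_ (nmon_rho u) * horner_alg s_ (nmon_rho v)
    + horner_alg s_ (nmon_rho u) * horner_alg r_ (nmon_rho v)
  else 0.

Lemma nmon_D2_ceq (s t : nmon) : ceq s t -> nmon_D2 s = nmon_D2 t.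
Proof.
elim: s t => [|u IHu v IHv] [|u' v'] //=.
case/orP=> /andP[eu ev]; rewrite (IHu _ eu) (IHv _ ev)
  (nmon_rho_ceq eu) (nmon_rho_ceq ev) //.
rewrite [nmon_D2 v' + _]addrC -!addrA; congr (_ + _).
by rewrite addrC; congr (_ + _); rewrite mulrC.
Qed.

Definition D2 : fcna F -> {mpoly F[3]} := fglift (fun m => nmon_D2 (repr m)).

Lemma D2_gen : D2 gen = 0.
Proof. by rewrite /D2 liftU scale1r (nmon_D2_ceq (ceq_repr NX)). Qed.

Lemma D2M u v :
  D2 << cmul u v >> = q_ * (D2 << u >> + D2 << v >>)
    + rho_at << u >> r_ * rho_at << v >> s_
    + rho_at << u >> s_ * rho_at << v >> r_.
Proof.
by rewrite /D2 /rho_at /rho !liftU !scale1r (nmon_D2_ceq (ceq_repr (NM _ _))).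
Qed.

Lemma fcna_linear_ext (M : lmodType F) (f g : {linear fcna F -> M}) :
  (forall m, f << m >> = g << m >>) -> f =1 g.
Proof.
move=> fg P; rewrite -(freeg_sumE P) !linear_sum; apply: eq_bigr => m _.
have -> : << coeff m P *g m >> = coeff m P *: (<< m >> : fcna F).
  by apply/eqP/freeg_eqP => k; rewrite coeffZ !coeffU mul1r.
by rewrite !linearZ /= fg.
Qed.

Lemma rho_unique (f : {linear fcna F -> {poly F}}) :
  f gen = 1 ->
  (forall u v, f << cmul u v >> = 'X * (f << u >> + f << v >>)) ->
  f =1 rho.
Proof.
move=> fX fM; apply: fcna_linear_ext; elim/cmon_ind => [|u v IHu IHv].
  exact: etrans fX (esym rho_gen).
by rewrite fM IHu IHv -rhoM.
Qed.

Lemma D2_unique (f : {linear fcna F -> {mpoly F[3]}}) :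
  f gen = 0 ->
  (forall u v, f << cmul u v >> = q_ * (f << u >> + f << v >>)
     + rho_at << u >> r_ * rho_at << v >> s_
     + rho_at << u >> s_ * rho_at << v >> r_) ->
  f =1 D2.
Proof.
move=> fX fM; apply: fcna_linear_ext; elim/cmon_ind => [|u v IHu IHv].
  exact: etrans fX (esym D2_gen).
by rewrite fM IHu IHv -D2M.
Qed.

Definition homogeneous (d : nat) P : Prop :=
  {in dom P, forall m, cmon_deg m = d}.

Definition evanescent P : Prop := rho P = 0.

Definition evanescent_homog (d : nat) P : Prop :=
  homogeneous d P /\ evanescent P.

(* The degree in q; it is 0 on the zero polynomial. *)
Definition degq (p : {mpoly F[3]}) : nat := \max_(m <- msupp p) m vq.

End FreeCommutativeNonassociative.

Notation "u ⋆ v" := (nmul u v) (at level 40, left associativity) : ring_scope.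
Notation "u ^⋆ n" := (npow u n) (at level 29, left associativity) : ring_scope.

Section SpecialElements.
Variable F : fieldType.
Let x : fcna F := gen F.

Definition E1 : fcna F := (x ^⋆ 2) ^⋆ 3 - (x ^⋆ 3) ^⋆ 2.

Definition E2 : fcna F :=
  (x ^⋆ 3) ^⋆ 2 + x ⋆ (x ⋆ (x ^⋆ 2) ^⋆ 2) - x ^⋆ 2 ⋆ x ^⋆ 4
  - x ⋆ (x ^⋆ 2 ⋆ x ^⋆ 3).

End SpecialElements.

(* Main.v *)
Require Import Defs.
From HB Require Import structures.
From mathcomp Require Import all_boot all_algebra.
From mathcomp.multinomials Require Import freeg mpoly.
From mathcomp Require Import zify ring.

Set Implicit Arguments.
Unset Strict Implicit.
Unset Printing Implicit Defensive.

Import GRing.Theory.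
Local Open Scope ring_scope.

(** The polynomials [D2 (E1 F)] and [D2 (E2 F)] come straight from the recursion
    defining [D2] on monomials ([D2_E1], [D2_E2]). The rest follows from
    [evanescent6]: every evanescent polynomial of degree 6 is a combination
    [a E2 + b E1].

    To see this, note that there are just six commutative monomials of degree 6
    ([cmon_deg6]). Evanescence says that the five coefficients of [rho E]
    vanish; in characteristic other than 2 this linear system in six unknowns
    has rank 4, and its plane of solutions is spanned by [E1] and [E2].

    Thus [D2 E = a D2 (E2 F) + b D2 (E1 F)], of degree at most 2 in [q] because
    the two summands have degree at most 2 and 1. For the exact degree, put
    [r = s = 0] ([at_rs0]): the value becomes [2a q^2 + 2(b - a) q]. As [2] is
    invertible, degree 1 in [q] forces [a = 0], and then [b] is nonzero because
    [D2 E] is; conversely the value [2b q] shows that [D2 (b E1)] has degree 1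
    for every nonzero [b]. *)

(** * Commutative monomials of degree at most six *)

Definition cX2 : cmon := cmul cX cX.
Definition cX3 : cmon := cmul cX cX2.
Definition cX4 : cmon := cmul cX cX3.
Definition cX22 : cmon := cmul cX2 cX2.

Lemma cmon_deg_gt0 (m : cmon) : (0 < cmon_deg m)%N.
Proof.
by elim/cmon_ind: m => [|u v]; rewrite ?cmon_degX // cmon_degM addn_gt0 => ->.
Qed.

Lemma cmon_splitP (m : cmon) : m = cX \/
  exists u v, [/\ m = cmul u v, (cmon_deg u <= cmon_deg v)%N
    & cmon_deg m = (cmon_deg u + cmon_deg v)%N].
Proof.
elim/cmon_ind: m => [|u v _ _]; [by left | right].
case: (leqP (cmon_deg u) (cmon_deg v)) => [le_uv | /ltnW le_vu].
  by exists u, v; rewrite cmon_degM.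
by exists v, u; rewrite cmon_degM cmulC addnC.
Qed.

Lemma cmon_deg1 (m : cmon) : cmon_deg m = 1%N -> m = cX.
Proof.
case: (cmon_splitP m) => [//|[u [v [_ _ ->]]]].
have := cmon_deg_gt0 u; have := cmon_deg_gt0 v; lia.
Qed.

(** With the factor of lower degree put first, the degree of [u] alone selects
    the case, and only its values up to half the total degree occur. *)
Lemma cmon_split_deg d m : cmon_deg m = d.+2 ->
  exists u v, [/\ m = cmul u v, (0 < cmon_deg u <= d.+2./2)%N
    & cmon_deg v = (d.+2 - cmon_deg u)%N].
Proof.
case: (cmon_splitP m) => [->|[u [v [-> le_uv ->]]] deg_m].
  by rewrite cmon_degX.
exists u, v; rewrite cmon_deg_gt0; split=> //; lia.
Qed.

Lemma cmon_deg2 m : cmon_deg m = 2 -> m = cX2.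
Proof.
move=> /cmon_split_deg[u [v [->]]].
case: (cmon_deg u) (@cmon_deg1 u) => [|[|//]] //= -> // _.
by move=> /cmon_deg1 ->.
Qed.

Lemma cmon_deg3 m : cmon_deg m = 3 -> m = cX3.
Proof.
move=> /cmon_split_deg[u [v [->]]].
case: (cmon_deg u) (@cmon_deg1 u) => [|[|//]] //= -> // _.
by move=> /cmon_deg2 ->.
Qed.

Lemma cmon_deg4 m : cmon_deg m = 4 -> m = cX4 \/ m = cX22.
Proof.
move=> /cmon_split_deg[u [v [->]]].
case: (cmon_deg u) (@cmon_deg1 u) (@cmon_deg2 u) => [|[|[|//]]] //= u1 u2 _.
  by move=> /cmon_deg3 ->; rewrite u1 //; left.
by move=> /cmon_deg2 ->; rewrite u2 //; right.
Qed.

Lemma cmon_deg5 m : cmon_deg m = 5 ->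
  [\/ m = cmul cX cX4, m = cmul cX cX22 | m = cmul cX2 cX3].
Proof.
move=> /cmon_split_deg[u [v [->]]].
case: (cmon_deg u) (@cmon_deg1 u) (@cmon_deg2 u) => [|[|[|//]]] //= u1 u2 _.
  by rewrite u1 // => /cmon_deg4[] ->; [constructor 1 | constructor 2].
by move=> /cmon_deg3 ->; rewrite u2 //; constructor 3.
Qed.

Lemma cmon_deg6 m : cmon_deg m = 6 ->
  m \in [:: cmul cX (cmul cX cX4); cmul cX (cmul cX cX22);
            cmul cX (cmul cX2 cX3); cmul cX2 cX4; cmul cX2 cX22;
            cmul cX3 cX3].
Proof.
move=> /cmon_split_deg[u [v [->]]].
case: (cmon_deg u) (@cmon_deg1 u) (@cmon_deg2 u) (@cmon_deg3 u)
  => [|[|[|[|//]]]] //= u1 u2 u3 _.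
- by rewrite u1 // => /cmon_deg5[] ->; rewrite !inE eqxx ?orbT.
- by rewrite u2 // => /cmon_deg4[] ->; rewrite !inE eqxx ?orbT.
- by rewrite u3 // => /cmon_deg3 ->; rewrite !inE eqxx ?orbT.
Qed.

(** * The evanescent polynomials of degree six *)

HB.instance Definition _ (F : fieldType) := GRing.Linear.copy (@rho F) (@rho F).
HB.instance Definition _ (F : fieldType) := GRing.Linear.copy (@D2 F) (@D2 F).

Section Evanescent.
Variable F : fieldType.
Local Notation mon m := (<< m >> : fcna F).

Lemma fcna_span6 (E : fcna F) : homogeneous 6 E ->
  exists a1 a2 a3 b1 b2 c : F,
    E = a1 *: mon (cmul cX (cmul cX cX4)) + a2 *: mon (cmul cX (cmul cX cX22))
      + a3 *: mon (cmul cX (cmul cX2 cX3)) + b1 *: mon (cmul cX2 cX4)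
      + b2 *: mon (cmul cX2 cX22) + c *: mon (cmul cX3 cX3).
Proof.
move=> homE; rewrite -(freeg_sumE E) big_seq.
elim/big_ind: _ => [|_ _ [a1 [a2 [a3 [b1 [b2 [c ->]]]]]]
    [a1' [a2' [a3' [b1' [b2' [c' ->]]]]]]|m /homE/cmon_deg6 mE].
- by exists 0, 0, 0, 0, 0, 0; rewrite !scale0r !addr0.
- exists (a1 + a1'), (a2 + a2'), (a3 + a3'), (b1 + b1'), (b2 + b2'), (c + c').
  by rewrite !scalerDl; do 5![rewrite addrACA; congr (_ + _)].
have -> : << coeff m E *g m >> = coeff m E *: mon m.
  by apply/eqP/freeg_eqP => k; rewrite coeffZ !coeffU mul1r.
set k := coeff m E; move: mE; rewrite !inE.
case/or4P=> [/eqP-> | /eqP-> | /eqP-> | /or3P[] /eqP->].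
- by exists k, 0, 0, 0, 0, 0; rewrite !scale0r ?(addr0, add0r).
- by exists 0, k, 0, 0, 0, 0; rewrite !scale0r ?(addr0, add0r).
- by exists 0, 0, k, 0, 0, 0; rewrite !scale0r ?(addr0, add0r).
- by exists 0, 0, 0, k, 0, 0; rewrite !scale0r ?(addr0, add0r).
- by exists 0, 0, 0, 0, k, 0; rewrite !scale0r ?(addr0, add0r).
- by exists 0, 0, 0, 0, 0, k; rewrite !scale0r ?(addr0, add0r).
Qed.

Lemma E1E : E1 F = mon (cmul cX2 cX22) - mon (cmul cX3 cX3).
Proof. by rewrite /E1 /npow /= /gen !nmulU. Qed.

Lemma E2E : E2 F = mon (cmul cX3 cX3) + mon (cmul cX (cmul cX cX22))
  - mon (cmul cX2 cX4) - mon (cmul cX (cmul cX2 cX3)).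
Proof. by rewrite /E2 /npow /= /gen !nmulU. Qed.

Lemma rho_cX : rho (mon cX) = 1.
Proof. exact: rho_gen. Qed.

Lemma two_cancel (charF : 2%N \notin [pchar F]) (x : F) : 2 * x = 0 -> x = 0.
Proof.
move/eqP; rewrite mulf_eq0 => /orP[/eqP two0|/eqP //].
by case/negP: charF; rewrite inE /= two0 eqxx.
Qed.

(** Write [E] with coefficients [a1, a2, a3] on [x(x x^4), x(x(x^2 x^2)),
    x(x^2 x^3)], [b1, b2] on [x^2 x^4, x^2(x^2 x^2)] and [c] on [x^3 x^3].
    The vanishing of the coefficients of [q], ..., [q^5] in [rho E] forces,
    once [2] is cancelled, [a1 = 0], [a3 = b1 = - a2] and [c = a2 - b2]. *)
Lemma evanescent6 (charF : 2%N \notin [pchar F]) (E : fcna F) :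
  evanescent_homog 6 E -> exists a b : F, E = a *: E2 F + b *: E1 F.
Proof.
case=> /fcna_span6[a1 [a2 [a3 [b1 [b2 [c ->]]]]]]; rewrite /evanescent.
rewrite !linearD !linearZ /= /cX4 /cX22 /cX3 /cX2 !(rhoM, rho_cX) => rho0.
have {}rho0 : Poly [:: 0; a1 + a2 + a3; a1 + a2 + 3 * b1 + 2 * b2 + 2 * c;
    a1 + 3 * a3 + b1 + 4 * b2 + 4 * c; a1 + 4 * a2 + 2 * a3 + 2 * b1; 2 * a1]
    = 0 :> {poly F}.
  by rewrite -[RHS]rho0 /= !cons_poly_def -!mul_polyC; ring.
have coef0 i : nth 0 [:: 0; a1 + a2 + a3; a1 + a2 + 3 * b1 + 2 * b2 + 2 * c;
    a1 + 3 * a3 + b1 + 4 * b2 + 4 * c; a1 + 4 * a2 + 2 * a3 + 2 * b1; 2 * a1] i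
    = 0.
  by rewrite -coef_Poly rho0 coef0.
have a1_0 : a1 = 0 by apply: (two_cancel charF); exact: (coef0 5).
have a3E : a3 = - a2.
  by apply/eqP; rewrite -subr_eq0 opprK addrC -[X in _ == X](coef0 1) a1_0 add0r.
have b1E : b1 = - a2.
  (* Twice the difference is the coefficient of [q^4]. *)
  apply/eqP; rewrite -subr_eq0; apply/eqP/(two_cancel charF).
  by rewrite -[RHS](coef0 4) /= a1_0 a3E; ring.
have cE : c = a2 - b2.
  (* Twice the difference is the coefficient of [q^2]. *)
  apply/eqP; rewrite -subr_eq0; apply/eqP/(two_cancel charF).
  by rewrite -[RHS](coef0 2) /= a1_0 b1E; ring.
exists a2, b2; rewrite E1E E2E a1_0 a3E b1E cE.
apply/eqP/freeg_eqP => m; rewrite !(coeffD, coeffN, coeffZ); ring.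
Qed.

(** * Second-order Peirce values of [E1] and [E2] *)

Lemma rho_at_cX (A : comAlgType F) (a : A) : rho_at (mon cX) a = 1.
Proof. by rewrite /rho_at rho_cX rmorph1. Qed.

Lemma rho_atM (A : comAlgType F) u v (a : A) :
  rho_at (mon (cmul u v)) a = a * (rho_at (mon u) a + rho_at (mon v) a).
Proof. by rewrite /rho_at rhoM rmorphM rmorphD /= horner_algX. Qed.

Lemma D2_cX : D2 (mon cX) = 0.
Proof. exact: D2_gen. Qed.

Local Notation q := (q_ F).
Local Notation r := (r_ F).
Local Notation s := (s_ F).

Lemma D2_E1 : D2 (E1 F) = 2 * (2 * r - 1) * (2 * s - 1) * (q - r * s).
Proof.
rewrite E1E linearB /= /cX22 /cX3 /cX2 !(D2M, D2_cX, rho_atM, rho_at_cX).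
ring.
Qed.

Lemma D2_E2 : D2 (E2 F) = (2 * r - 1) * (2 * s - 1)
  * ((q - 1) * (2 * q - r - s) - (r - s) ^+ 2).
Proof.
rewrite E2E !(linearB, linearD) /= /cX22 /cX4 /cX3 /cX2.
rewrite !(D2M, D2_cX, rho_atM, rho_at_cX).
ring.
Qed.

(** * The degree in [q] *)

(** Only upper bounds on [degq] pass to sums and products without regard to
    cancellation among the terms of highest degree in [q]. *)
Lemma degq_leP (p : {mpoly F[3]}) d :
  reflect {in msupp p, forall m : 'X_{1..3}, (m vq <= d)%N} (degq p <= d)%N.
Proof.
apply: (iffP (bigmax_leqP_seq _ _ _ _)) => le_d m mp; first exact: le_d.
by move=> _; apply: le_d.
Qed.

Lemma degqB_le d (p1 p2 : {mpoly F[3]}) :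
  (degq p1 <= d)%N -> (degq p2 <= d)%N -> (degq (p1 - p2) <= d)%N.
Proof.
move=> /degq_leP le1 /degq_leP le2; apply/degq_leP => m /msuppB_le.
by rewrite mem_cat => /orP[/le1|/le2].
Qed.

Lemma degqD_le d (p1 p2 : {mpoly F[3]}) :
  (degq p1 <= d)%N -> (degq p2 <= d)%N -> (degq (p1 + p2) <= d)%N.
Proof.
move=> /degq_leP le1 /degq_leP le2; apply/degq_leP => m /msuppD_le.
by rewrite mem_cat => /orP[/le1|/le2].
Qed.

Lemma degqM_le d1 d2 (p1 p2 : {mpoly F[3]}) :
  (degq p1 <= d1)%N -> (degq p2 <= d2)%N -> (degq (p1 * p2) <= d1 + d2)%N.
Proof.
move=> /degq_leP le1 /degq_leP le2; apply/degq_leP => m /msuppM_le.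
case/allpairsP=> -[m1 m2] /= [/le1 le_m1 /le2 le_m2 ->].
by rewrite mnmDE leq_add.
Qed.

Lemma degqZ_le d c (p : {mpoly F[3]}) :
  (degq p <= d)%N -> (degq (c *: p) <= d)%N.
Proof. by move=> /degq_leP le_p; apply/degq_leP => m /msuppZ_le/le_p. Qed.

Lemma degq_nat (n : nat) : degq (n%:R : {mpoly F[3]}) = 0%N.
Proof.
apply/eqP; rewrite -leqn0; apply/degq_leP => m.
rewrite -(rmorph_nat (@mpolyC 3 F)) msuppC; case: ifP => // _.
by rewrite inE => /eqP ->; rewrite mnm0E.
Qed.

Lemma degq_var (i : 'I_3) : degq ('X_i : {mpoly F[3]}) = (i == vq).
Proof. by rewrite /degq msuppX big_seq1 mnm1E. Qed.

(** Killing [r] and [s] turns a polynomial into one in the single variable [q];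
    a coefficient that survives bounds the degree in [q] from below. *)
Definition at_rs0 : {mpoly F[3]} -> {poly F} :=
  mmap polyC (fun i => if i == vq then 'X else 0).

HB.instance Definition _ := GRing.RMorphism.copy at_rs0 at_rs0.

Lemma size_at_rs0 p : (size (at_rs0 p) <= (degq p).+1)%N.
Proof.
rewrite /at_rs0 /mmap big_seq.
apply: (leq_trans (size_sum _ _ _)); apply/bigmax_leqP_seq => m _ mp.
rewrite mul_polyC (leq_trans (size_scale_leq _ _)) // /mmap1 (bigD1 vq) //=.
have le_m : (m vq <= degq p)%N by apply: (degq_leP _ _ (leqnn _)).
set rest : {poly F} := (X in _ * X).
(* Each power of a variable sent to [0] is [1] or [0]. *)
have [->|->] : rest = 0 \/ rest = 1; last by rewrite mulr1 size_polyXn.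
  elim/big_ind: rest => [|x y [->|->] [->|->]|i /negPf ->].
  - by right.
  - by left; rewrite mulr0.
  - by left; rewrite mul0r.
  - by left; rewrite mulr0.
  - by right; rewrite mulr1.
  - by rewrite expr0n; case: (m i == 0)%N; [right | left].
by rewrite mulr0 size_poly0.
Qed.

Lemma degq_ge d p : (at_rs0 p)`_d != 0 -> (d <= degq p)%N.
Proof.
apply: contraNT; rewrite -ltnNge => lt_d; apply/eqP.
by rewrite nth_default // (leq_trans (size_at_rs0 p)).
Qed.

Lemma at_rs0_q : at_rs0 q = 'X.
Proof. by rewrite /at_rs0 mmapX mmap1U. Qed.

Lemma at_rs0_r : at_rs0 r = 0.
Proof. by rewrite /at_rs0 mmapX mmap1U. Qed.

Lemma at_rs0_s : at_rs0 s = 0.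
Proof. by rewrite /at_rs0 mmapX mmap1U. Qed.

Lemma at_rs0Z (c : F) p : at_rs0 (c *: p) = c *: at_rs0 p.
Proof. by rewrite /at_rs0 mmapZ mul_polyC. Qed.

Lemma at_rs0_D2_E1 : at_rs0 (D2 (E1 F)) = 2 *: 'X.
Proof.
rewrite D2_E1 !(rmorphM, rmorphB, rmorph_nat, rmorph1) /=.
rewrite at_rs0_q at_rs0_r at_rs0_s -mul_polyC rmorph_nat; ring.
Qed.

Lemma at_rs0_D2_E2 : at_rs0 (D2 (E2 F)) = 2 *: 'X^2 - 2 *: 'X.
Proof.
rewrite D2_E2 !(rmorphM, rmorphB, rmorphXn, rmorph_nat, rmorph1) /=.
rewrite at_rs0_q at_rs0_r at_rs0_s -!mul_polyC rmorph_nat; ring.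
Qed.

Let degq_q : (degq q <= 1)%N. Proof. by rewrite degq_var. Qed.
Let degq_r : (degq r <= 0)%N. Proof. by rewrite degq_var. Qed.
Let degq_s : (degq s <= 0)%N. Proof. by rewrite degq_var. Qed.
Let degq_nat_le n d : (degq (n%:R : {mpoly F[3]}) <= d)%N.
Proof. by rewrite degq_nat. Qed.

(* The common factor of both second-order values is constant in [q]. *)
Let degq_rs : (degq ((2 * r - 1) * (2 * s - 1)) <= 0)%N.
Proof.
have lin i : i != vq -> (degq (2 * 'X_i - 1 : {mpoly F[3]}) <= 0)%N.
  move=> /negPf i_q; apply: degqB_le; last exact: (degq_nat_le 1).
  by apply: (degqM_le (d1 := 0) (d2 := 0)); rewrite ?degq_nat ?degq_var ?i_q.
by apply: (degqM_le (d1 := 0) (d2 := 0)); apply: lin.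
Qed.

Lemma degq_D2_E1 : (degq (D2 (E1 F)) <= 1)%N.
Proof.
rewrite D2_E1 -(mulrA 2); apply: (degqM_le (d1 := 0) (d2 := 1)).
  exact: (degqM_le (d1 := 0) (d2 := 0)).
apply: degqB_le => //; apply: leqW.
exact: (degqM_le (d1 := 0) (d2 := 0)).
Qed.

Lemma degq_D2_E2 : (degq (D2 (E2 F)) <= 2)%N.
Proof.
rewrite D2_E2; apply: (degqM_le (d1 := 0) (d2 := 2)) => //.
apply: degqB_le.
  apply: (degqM_le (d1 := 1) (d2 := 1)).
    by apply: degqB_le => //; apply: (degq_nat_le 1).
  apply: degqB_le; last exact: leqW.
  apply: degqB_le; last exact: leqW.
  exact: (degqM_le (d1 := 0) (d2 := 1)).
rewrite expr2; apply: leqW; apply: leqW.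
by apply: (degqM_le (d1 := 0) (d2 := 0)); apply: degqB_le.
Qed.

End Evanescent.

(** * Second-order values of evanescent polynomials of degree six *)

Theorem proposition5p3 (F : fieldType) (charF : 2%N \notin [pchar F]) :
  let q := q_ F in let r := r_ F in let s := s_ F in
  [/\ D2 (E1 F) = 2 * (2 * r - 1) * (2 * s - 1) * (q - r * s),
      D2 (E2 F) = (2 * r - 1) * (2 * s - 1)
                  * ((q - 1) * (2 * q - r - s) - (r - s) ^+ 2),
      (2 * r - 1) * (2 * s - 1) * ((q - 1) * (2 * q - r - s) - (r - s) ^+ 2)
      = (2 * r - 1) * (2 * s - 1)
        * (2 * q ^+ 2 - (r + s + 2) * q - (r - s) ^+ 2 + r + s)
    & forall E : fcna F, evanescent_homog 6 E ->
        (degq (D2 E) <= 2)%N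
        /\ (degq (D2 E) = 1%N <-> exists c : F, c != 0 /\ E = c *: E1 F)].
Proof.
move=> q r s; split; [exact: D2_E1 | exact: D2_E2 | ring | move=> E].
case/(evanescent6 charF)=> a [b ->]; rewrite linearD !linearZ /=.
have two0 c : c != 0 -> c * 2 != 0 :> F.
  by apply: contra_neq; rewrite mulrC => /(two_cancel charF).
have coefE i : (at_rs0 (a *: D2 (E2 F) + b *: D2 (E1 F)))`_i
    = a * (2 * (i == 2)%:R - 2 * (i == 1)%:R) + b * (2 * (i == 1)%:R).
  rewrite rmorphD /= !at_rs0Z at_rs0_D2_E1 at_rs0_D2_E2.
  by rewrite coefD !coefZ coefB !coefZ coefXn coefX.
split.
  by apply: degqD_le; apply: degqZ_le; [exact: degq_D2_E2 | exact/leqW/degq_D2_E1].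
split=> [deg1 | [c [c0 Ec]]].
  (* Otherwise [2 * a] is a nonzero coefficient of [q^2] at [r = s = 0]. *)
  have a0 : a = 0.
    apply/eqP; apply: contraTT (leqnn 1%N) => /two0 a0; rewrite -ltnNge.
    rewrite -{2}deg1; apply: degq_ge.
    by rewrite coefE /= mulr0 subr0 mulr1 !mulr0 addr0.
  exists b; rewrite a0 scale0r add0r; split=> //.
  apply: contra_eq_neq deg1 => ->; rewrite a0 !scale0r addr0.
  by rewrite (degq_nat F 0).
rewrite -!linearZ -linearD /= Ec linearZ /=.
apply/eqP; rewrite eqn_leq degqZ_le ?degq_D2_E1 //=.
apply: degq_ge; rewrite at_rs0Z at_rs0_D2_E1 !coefZ coefX mulr1.
exact: two0.
Qed.
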